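(* There exists an absolute constant $c'>0$ (independent of $\theta$ and $N$) such that for every $\theta\in(0,\pi/4)$, setting $\Omega=[-\theta,\theta]$, and for every positive integer $N$, $$D(N,\mathcal{R}_{\Omega})\ \ge\ c'\,\theta\,N^{1/5}.$$
   Context: For a set $\Omega\subset[-\frac{\pi}{4},\frac{\pi}{4}]$ of angles, $\mathcal{R}_{\Omega}$ denotes the class of all (arbitrary side lengths, arbitrary position) rectangles $R\subset\mathbb{R}^2$ such that one side of $R$ makes an angle $\omega\in\Omega$ with the $x$-axis. For an $N$-point set $P\subset[0,1]^2$, the directional discrepancy is $$D(P,\mathcal{R}_{\Omega})=\sup_{R\in\mathcal{R}_{\Omega}}\Big|\,|P\cap R|-N\cdot\mathrm{vol}(R\cap[0,1]^2)\Big|,$$ where $|P\cap R|$ is the number of points of $P$ in $R$ and $\mathrm{vol}$ is two-dimensional Lebesgue measure. The optimal directional discrepancy is $$D(N,\mathcal{R}_{\Omega})=\inf_{P\subset[0,1]^2,\ |P|=N}D(P,\mathcal{R}_{\Omega}).$$ *)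

(* Defs.v *)
From HB Require Import structures.
From mathcomp Require Import all_boot all_order all_algebra finmap.
From mathcomp Require Import all_classical all_reals all_analysis.

Set Implicit Arguments.
Unset Strict Implicit.
Unset Printing Implicit Defensive.

Import Order.TTheory GRing.Theory Num.Theory.
Import numFieldNormedType.Exports.

Local Open Scope fset_scope.
Local Open Scope classical_set_scope.
Local Open Scope ring_scope.

Definition unit_square {R : realType} : set (R * R) := `[0, 1] `*` `[0, 1].

Definition area (R : realType) (A : set (R * R)) : \bar R :=
  (@lebesgue_measure R \x @lebesgue_measure R)%E A.

(* The closed rectangle with corner [a] and sides of lengths [l1] and [l2]
   along the orthonormal directions (cos w, sin w) and (- sin w, cos w). *)
Definition rectangle (R : realType) (w : R) (a : R * R) (l1 l2 : R) :
    set (R * R) :=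
  [set (a.1 + s.1 * cos w - s.2 * sin w, a.2 + s.1 * sin w + s.2 * cos w)
    | s in `[0, l1] `*` `[0, l2]].

Definition rectangles (R : realType) (Omega : set R) : set (set (R * R)) :=
  [set A | exists (w : R) (a : R * R) (l1 l2 : R),
    [/\ Omega w, 0 < l1, 0 < l2 & A = rectangle w a l1 l2]].

Definition local_discrepancy (R : realType) (P : {fset R * R})
    (A : set (R * R)) : \bar R :=
  `| (#|` [fset p in P | p \in A]|)%:R%:E
     - (#|` P|)%:R%:E * area (A `&` unit_square) |%E.

(* Suprema and infima are taken in the extended reals, so that no
   boundedness side condition is hidden in the definitions. *)
Definition discrepancy (R : realType) (P : {fset R * R})
    (F : set (set (R * R))) : \bar R :=
  ereal_sup [set local_discrepancy P A | A in F].

Definition optimal_discrepancy (R : realType) (N : nat)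
    (F : set (set (R * R))) : \bar R :=
  ereal_inf [set discrepancy P F | P in
    [set P : {fset R * R} | [set` P] `<=` unit_square /\ #|` P| = N]].

(* Main.v *)
Require Import Defs.
From HB Require Import structures.
From mathcomp Require Import all_boot all_order all_algebra finmap.
From mathcomp Require Import all_classical all_reals all_analysis.
From mathcomp Require Import measurable_realfun ring lra zify.

(* Let D bound the discrepancy of the point set and put v_i = y_i - b x_i. Wrapped
   around modulo 1, the strip a <= v < a + w of slope b, |b| <= theta, meets the unit
   square in area exactly w, so it contains N w + O(D) points. Averaging the squared
   deviation over a gives, with tau_w(s) = (w - |s|)_+ / w^2 made 1-periodic,
     sum_(i,j) tau_w(v_i - v_j) <= N^2 + O(D^2 / w^2),
   and sum_(i,j) tau_W(v_i - v_j) >= N^2 because a variance is nonnegative. Hence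
   sum_(i,j) (tau_w - tau_W)(v_i - v_j) = O(D^2 / w^2) for every slope b.
   Now average over b with the weight (theta - |b|)_+. The diagonal contributes
   N (1/w - 1/W). For i <> j the average is, up to the factor (theta dx)^-2, a second
   difference with step theta dx of a function G, G'' = tau_w - tau_W, which satisfies
   -W/6 <= G <= 0 and vanishes outside [-W, W]. Thus a pair contributes at least
   -1/W when theta |dx| < W, at least -W / (theta dx)^2 otherwise, and nothing
   negative unless the points are within O(W) of a line of slope 0 or +-theta.
   Cutting these strips into blocks of size (W / theta) x W, each of which contains
   O(N W^2 / theta + D) points, bounds the negative part by a multiple of
   N (N W / theta + D / W). With W ~ (theta D / N)^(1/2) and w ~ W / D this gives
   D^5 >= c theta N. *)

Set Implicit Arguments.
Unset Strict Implicit.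
Unset Printing Implicit Defensive.

Import Order.TTheory GRing.Theory Num.Theory.
Import numFieldNormedType.Exports.

Local Open Scope ring_scope.

(** * Second differences *)

Section SecondDifference.
Variable R : realType.
Implicit Types (f g : R -> R) (r s h w x y z B : R).

Lemma le_of_le_add_divn x y z :
  (forall n : nat, x <= y + z / n.+1%:R) -> x <= y.
Proof.
move=> le_xy; rewrite leNgt; apply/negP => lt_yx.
have xy0 : 0 < x - y by rewrite subr_gt0.
pose n := Num.truncn (`|z| / (x - y)).
have := le_xy n; have : `|z| / (x - y) < n.+1%:R by rewrite truncnS_gt.
rewrite ltr_pdivrMr // => zn.
have n0 : 0 < n.+1%:R :> R by rewrite ltr0n.
rewrite -lerBlDl ler_pdivlMr // => zn'.
have := ler_norm z; lra.
Qed.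

Definition diff2 f s h := f (s + h) + f (s - h) - 2 * f s.

(* A quantitative form of "f'' = g" that needs no differentiation. *)
Definition has_diff2 f g := exists C : R, forall s h, 0 <= h ->
  `|diff2 f s h - h ^+ 2 * g s| <= C * h ^+ 3.

Lemma diff2_double f s h :
  diff2 f s (2 * h) = diff2 f (s + h) h + 2 * diff2 f s h + diff2 f (s - h) h.
Proof.
rewrite /diff2 (_ : s + h - h = s); last by ring.
rewrite (_ : s - h + h = s); last by ring.
rewrite (_ : s + h + h = s + 2 * h); last by ring.
rewrite (_ : s - h - h = s - 2 * h); last by ring.
ring.
Qed.

(* Doubling the step n times starting from r / 2^n only loses C r^3 / 2^n. *)
Lemma diff2_le f g r B : 0 <= r -> has_diff2 f g ->
  (forall s, `|s| <= r -> g s <= B) -> diff2 f 0 r <= r ^+ 2 * B.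
Proof.
move=> r0 [C fgC] gB.
have scale n : forall s h, 0 <= h -> `|s| + 2 ^+ n * h <= r ->
    diff2 f s (2 ^+ n * h) <= 4 ^+ n * (h ^+ 2 * B + C * h ^+ 3).
  elim: n => [|n IH] s h h0 sr.
    rewrite expr0 !mul1r; rewrite expr0 mul1r in sr.
    have := fgC s h h0; rewrite ler_norml => /andP[_]; rewrite lerBlDl => le1.
    have := gB s; rewrite (le_trans _ sr) ?lerDl // => /(_ isT) gsB.
    apply: (le_trans le1); rewrite lerD2r ler_wpM2l // sqr_ge0 //.
  have k0 : 0 <= 2 ^+ n * h by rewrite mulr_ge0 // exprn_ge0.
  rewrite exprS -mulrA diff2_double; rewrite exprS -mulrA in sr.
  have n1 := ler_normD s (2 ^+ n * h); have n2 := ler_normB s (2 ^+ n * h).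
  rewrite (ger0_norm k0) in n1 n2.
  have := IH (s + 2 ^+ n * h) h h0; have := IH s h h0.
  have := IH (s - 2 ^+ n * h) h h0.
  rewrite [4 ^+ n.+1]exprS -mulrA.
  move=> /(_ _)/wrap[|i1]; first lra.
  move=> /(_ _)/wrap[|i2]; first lra.
  move=> /(_ _)/wrap[|i3]; first lra.
  lra.
apply: (@le_of_le_add_divn _ _ (`|C| * r ^+ 3)) => n.
have p0 : 0 < 2 ^+ n :> R by rewrite exprn_gt0.
have := scale n 0 (r / 2 ^+ n).
have rn0 : 0 <= r / 2 ^+ n by rewrite divr_ge0 // ltW.
rewrite normr0 add0r [2 ^+ n * _]mulrC divfK ?gt_eqF // => /(_ rn0 (lexx _)) le1.
apply: (le_trans le1).
have -> : 4 ^+ n = (2 ^+ n) ^+ 2 :> R by rewrite -exprM mulnC exprM; congr (_ ^+ _); ring.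
have -> : (2 ^+ n) ^+ 2 * ((r / 2 ^+ n) ^+ 2 * B + C * (r / 2 ^+ n) ^+ 3) =
   r ^+ 2 * B + C * r ^+ 3 / 2 ^+ n.
  by field; rewrite gt_eqF.
rewrite lerD2l.
have r3 : 0 <= r ^+ 3 by rewrite exprn_ge0.
apply: (@le_trans _ _ (`|C| * r ^+ 3 / 2 ^+ n)).
  by apply: ler_wpM2r; [rewrite invr_ge0 ltW | apply: ler_wpM2r => //; exact: ler_norm].
rewrite ler_wpM2l ?mulr_ge0 // lef_pV2 ?posrE ?ltr0n // -natrX ler_nat.
by rewrite ltn_expl.
Qed.

Lemma has_diff2N f g : has_diff2 f g -> has_diff2 (fun s => - f s) (fun s => - g s).
Proof.
move=> [C fg]; exists C => s h h0.
by rewrite -normrN (le_trans _ (fg s h h0)) // /diff2 le_eqVlt; apply/orP; left;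
  apply/eqP; congr (`|_|); ring.
Qed.

Lemma diff2_ge f g r B : 0 <= r -> has_diff2 f g ->
  (forall s, `|s| <= r -> B <= g s) -> r ^+ 2 * B <= diff2 f 0 r.
Proof.
move=> r0 /has_diff2N fg gB; rewrite -lerN2.
have := diff2_le (B := - B) r0 fg.
rewrite mulrN => h; apply: le_trans (h _).
  by rewrite /diff2 le_eqVlt; apply/orP; left; apply/eqP; ring.
by move=> s /gB; rewrite lerN2.
Qed.

Lemma has_diff2D f1 f2 g1 g2 : has_diff2 f1 g1 -> has_diff2 f2 g2 ->
  has_diff2 (fun s => f1 s + f2 s) (fun s => g1 s + g2 s).
Proof.
move=> [C1 fg1] [C2 fg2]; exists (C1 + C2) => s h h0.
rewrite mulrDl.
have -> : diff2 (fun s0 => f1 s0 + f2 s0) s h - h ^+ 2 * (g1 s + g2 s) =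
  (diff2 f1 s h - h ^+ 2 * g1 s) + (diff2 f2 s h - h ^+ 2 * g2 s).
  by rewrite /diff2; ring.
by rewrite (le_trans (ler_normD _ _)) // lerD ?fg1 ?fg2.
Qed.

Lemma has_diff2_sum (I : Type) (r : seq I) (F G : I -> R -> R) :
  (forall i, has_diff2 (F i) (G i)) ->
  has_diff2 (fun s => \sum_(i <- r) F i s) (fun s => \sum_(i <- r) G i s).
Proof.
move=> FG; elim: r => [|i r IH].
  exists 0 => s h h0; rewrite /diff2 !big_nil.
  by rewrite (_ : _ - _ = 0) ?normr0 ?mul0r //; ring.
have [C HC] := has_diff2D (FG i) IH.
exists C => s h h0; have := HC s h h0.
by rewrite /diff2 !big_cons.
Qed.

Lemma diff2_sum (I : Type) (r : seq I) (F : I -> R -> R) s h :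
  diff2 (fun s => \sum_(i <- r) F i s) s h = \sum_(i <- r) diff2 (F i) s h.
Proof. by rewrite /diff2 mulr_sumr -big_split -sumrB. Qed.

Lemma has_diff2Z f g c : has_diff2 f g ->
  has_diff2 (fun s => c * f s) (fun s => c * g s).
Proof.
move=> [C fg]; exists (`|c| * C) => s h h0.
have -> : diff2 (fun s0 => c * f s0) s h - h ^+ 2 * (c * g s) =
  c * (diff2 f s h - h ^+ 2 * g s) by rewrite /diff2; ring.
by rewrite normrM -[leRHS]mulrA; apply: ler_wpM2l => //; exact: fg.
Qed.

Lemma has_diff2_shift f g c : has_diff2 f g ->
  has_diff2 (fun s => f (s + c)) (fun s => g (s + c)).
Proof.
move=> [C fg]; exists C => s h h0; have := fg (s + c) h h0.
by rewrite /diff2 !(addrAC s c).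
Qed.

Lemma has_diff2_affine f g a c : has_diff2 f g ->
  has_diff2 (fun s => f (c - s * a)) (fun s => a ^+ 2 * g (c - s * a)).
Proof.
move=> [C fg]; exists (C * `|a| ^+ 3) => s h h0.
have := fg (c - s * a) (h * `|a|).
rewrite mulr_ge0 // => /(_ isT).
rewrite !exprMn real_normK ?num_real //.
have -> : diff2 f (c - s * a) (h * `|a|) = diff2 (fun s => f (c - s * a)) s h.
  rewrite /diff2; case: (ger0P a) => _.
    rewrite (_ : c - s * a + h * a = c - (s - h) * a); last by ring.
    rewrite (_ : c - s * a - h * a = c - (s + h) * a); last by ring.
    ring.
  rewrite (_ : c - s * a + h * - a = c - (s + h) * a); last by ring.
  rewrite (_ : c - s * a - h * - a = c - (s - h) * a); last by ring.
  ring.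
rewrite (_ : C * `|a| ^+ 3 * h ^+ 3 = C * (h ^+ 3 * `|a| ^+ 3)); last by ring.
by rewrite mulrA.
Qed.

Definition tent w s := Num.max 0 (w - `|s|).

(* The even second antiderivative of [tent w / w ^+ 2] that equals [ `|s| / 2] outside
   [-w, w]; it is the second difference of [ `|s| ^+ 3] in [spline_norm3]. *)
Definition spline w s := `|s| / 2 + Num.max 0 (w - `|s|) ^+ 3 / (6 * w ^+ 2).

Lemma diff2_norm3 s h : 0 <= h ->
  diff2 (fun s => `|s| ^+ 3) s h = 6 * h ^+ 2 * `|s| + 2 * Num.max 0 (h - `|s|) ^+ 3.
Proof.
move=> h0; wlog s0 : s / 0 <= s.
  move=> H; have [s0|s0] := leP 0 s; first exact: H.
  have := H (- s); rewrite normrN oppr_ge0 => /(_ (ltW s0)) <-.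
  rewrite /diff2 normrN -[ `|s + h|]normrN -[ `|s - h|]normrN !opprD opprK.
  by congr (_ - _); rewrite addrC.
rewrite /diff2 (ger0_norm s0) (ger0_norm (addr_ge0 s0 h0)).
have [sh|hs] := leP h s.
  by rewrite ger0_norm ?subr_ge0 // max_l ?subr_le0 //; ring.
by rewrite ltr0_norm ?subr_lt0 // max_r ?subr_ge0 ?ltW //; ring.
Qed.

Lemma diff2_norm s h : 0 <= h -> diff2 (fun s => `|s|) s h = 2 * tent h s.
Proof.
move=> h0; rewrite /diff2 /tent.
case: (ger0P (s + h)) => ?; case: (ger0P (s - h)) => ?; case: (ger0P s) => ?;
  case: leP => ?; lra.
Qed.

Lemma spline_norm3 w s : 0 < w ->
  spline w s = (12 * w ^+ 2)^-1 * diff2 (fun s => `|s| ^+ 3) s w.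
Proof.
move=> w0; rewrite diff2_norm3 ?ltW // /spline; set a := Num.max _ _.
by field; rewrite gt_eqF.
Qed.

Lemma has_diff2_norm3 : has_diff2 (fun s => `|s| ^+ 3) (fun s => 6 * `|s|).
Proof.
exists 2 => s h h0; rewrite diff2_norm3 //.
have m0 : 0 <= Num.max 0 (h - `|s|) by rewrite le_max lexx.
rewrite (_ : _ - _ = 2 * Num.max 0 (h - `|s|) ^+ 3); last by ring.
rewrite ger0_norm; last by rewrite mulr_ge0 // exprn_ge0.
apply: ler_wpM2l => //; apply: lerXn2r; rewrite ?nnegrE //.
by rewrite ge_max h0 lerBlDr lerDl normr_ge0.
Qed.

Lemma has_diff2_spline w : 0 < w ->
  has_diff2 (spline w) (fun s => tent w s / w ^+ 2).
Proof.
move=> w0; have e0 := has_diff2_norm3.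
have [C HC] := has_diff2Z (12 * w ^+ 2)^-1 (has_diff2D (has_diff2D
  (has_diff2_shift w e0) (has_diff2_shift (- w) e0)) (has_diff2Z (- 2) e0)).
exists C => s h h0; have := HC s h h0.
set l := (X in `|X| <= _ -> _); set r := (X in _ -> `|X| <= _).
suff -> : l = r by [].
have t2 : tent w s = diff2 (fun s => `|s|) s w / 2.
  by rewrite diff2_norm ?ltW //; field.
rewrite /l /r t2 /diff2 !spline_norm3 // /diff2.
by field; rewrite gt_eqF.
Qed.

Lemma tent_ge0 w s : 0 <= tent w s.
Proof. by rewrite /tent le_max lexx. Qed.

Lemma tent_eq0 w s : w <= `|s| -> tent w s = 0.
Proof. by move=> ws; rewrite /tent max_l // subr_le0. Qed.

Lemma tent_le w s : 0 <= w -> tent w s <= w.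
Proof. by move=> w0; rewrite /tent ge_max w0 lerBlDr lerDl normr_ge0. Qed.

Lemma tent0 w : 0 <= w -> tent w 0 = w.
Proof. by move=> w0; rewrite /tent normr0 subr0 max_r. Qed.

Section SplineDifference.
Variables (w W : R).
Hypotheses (w0 : 0 < w) (wW : w <= W).

Lemma spline_sub_le0 s : spline w s - spline W s <= 0.
Proof.
have W0 : 0 < W by apply: lt_le_trans wW.
rewrite subr_le0 /spline lerD2l.
have [ws|sw] := leP w `|s|.
  rewrite max_l ?subr_le0 // expr0n /= mul0r mulr_ge0 ?exprn_ge0 ?le_max ?lexx //.
  by rewrite invr_ge0 mulr_ge0 // sqr_ge0.
have s0 := normr_ge0 s; set a := `|s| in s0 sw *.
have aw := ltW sw; have aW := le_trans aw wW.
rewrite !max_r ?subr_ge0 //.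
have -> : (w - a) ^+ 3 / (6 * w ^+ 2) = w * (1 - a / w) ^+ 3 / 6.
  by field; rewrite gt_eqF.
have -> : (W - a) ^+ 3 / (6 * W ^+ 2) = W * (1 - a / W) ^+ 3 / 6.
  by field; rewrite gt_eqF.
apply: ler_wpM2r; first by rewrite invr_ge0.
have x0 : 0 <= 1 - a / w by rewrite subr_ge0 ler_pdivrMr // mul1r ltW.
have xy : 1 - a / w <= 1 - a / W.
  by rewrite lerD2l lerN2; apply: ler_wpM2l => //; rewrite lef_pV2.
apply: ler_pM => //; first exact: ltW.
  exact: exprn_ge0.
by apply: lerXn2r => //; rewrite nnegrE // (le_trans x0).
Qed.

Lemma spline_sub_ge s : - (W / 6) <= spline w s - spline W s.
Proof.
have W0 : 0 < W by apply: lt_le_trans wW.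
rewrite /spline opprD addrACA subrr add0r.
apply: (@le_trans _ _ (- (Num.max 0 (W - `|s|) ^+ 3 / (6 * W ^+ 2)))); last first.
  rewrite lerDr divr_ge0 ?exprn_ge0 ?le_max ?lexx //.
  by rewrite mulr_ge0 // sqr_ge0.
rewrite lerN2 (_ : W / 6 = W ^+ 3 / (6 * W ^+ 2)); last by field; rewrite gt_eqF.
apply: ler_wpM2r; first by rewrite invr_ge0 mulr_ge0 // sqr_ge0.
have W1 := ltW W0.
apply: lerXn2r; rewrite ?nnegrE ?le_max ?lexx //.
by rewrite ge_max W1 lerBlDr lerDl normr_ge0.
Qed.

Lemma spline_sub_eq0 s : W <= `|s| -> spline w s - spline W s = 0.
Proof.
move=> Ws; rewrite /spline !max_l ?subr_le0 //; last exact: le_trans Ws.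
by rewrite expr0n /= !mul0r subrr.
Qed.

Lemma has_diff2_spline_sub :
  has_diff2 (fun s => spline w s - spline W s)
    (fun s => tent w s / w ^+ 2 - tent W s / W ^+ 2).
Proof.
apply: has_diff2D; first exact: has_diff2_spline.
by apply/has_diff2N/has_diff2_spline; apply: lt_le_trans wW.
Qed.

End SplineDifference.
End SecondDifference.

(** * Mean squares of strip counts *)

Section CyclicGrid.
Local Open Scope int_scope.
Variables (Q n : nat).
Hypotheses (Q0 : (0 < Q)%N) (nQ : (n <= Q)%N).
Implicit Types s d e : int.

Definition in_arc s : bool := ((s %% Q)%Z < n%:Z).

Lemma in_arc_eq s r : (r < Q)%N -> (exists q : int, s = q * Q%:Z + r%:Z) ->
  in_arc s = (r < n)%N.
Proof.
by move=> rQ [q ->]; rewrite /in_arc modzMDl modz_small ?ltz_nat.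
Qed.

Lemma int_divQ s : exists2 r : nat, (r < Q)%N & exists q : int, s = q * Q%:Z + r%:Z.
Proof.
have Qn0 : Q%:Z != 0 by rewrite eqz_nat -lt0n.
have r0 := modz_ge0 s Qn0.
have rQ' : (s %% Q%:Z)%Z < Q%:Z by apply: ltz_pmod; rewrite ltz_nat.
exists `|(s %% Q%:Z)%Z|%N.
  by rewrite -ltz_nat gez0_abs.
exists (s %/ Q%:Z)%Z; rewrite gez0_abs //; exact: divz_eq.
Qed.

Lemma in_arc_threshold (V : pzRingType) s (l : nat) : (l < Q)%N ->
  - Q%:Z <= s -> s < 2 * Q%:Z ->
  (in_arc (s - l%:Z))%:R = \sum_(m < 4)
    ((l%:Z + (m%:Z - 2) * Q%:Z <= s)%R%:R -
     (l%:Z + n%:Z + (m%:Z - 2) * Q%:Z <= s)%R%:R) :> V.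
Proof.
move=> lQ s1 s2; have [r rQ [q sq]] := int_divQ (s - l%:Z).
rewrite (in_arc_eq rQ); last by exists q.
have -> : s = l%:Z + q * Q%:Z + r%:Z by rewrite -addrA -sq; ring.
have q1 : (-2 <= q)%R by nia.
have q2 : (q <= 1)%R by nia.
rewrite !big_ord_recr big_ord0 /= add0r.
have : (q = -2 \/ q = -1 \/ q = 0 \/ q = 1)%R by lia.
case=> [|[|[|]]] ->;
repeat match goal with |- context [(?x <= ?y)%R] =>
  first [have -> : (x <= y)%R = true by lia | have -> : (x <= y)%R = false by lia
   | have -> : (x <= y)%R = ~~ (r < n)%N by lia ] end;
by case: (r < n)%N; rewrite /= ?subrr ?subr0 ?addr0 ?add0r.
Qed.

Lemma in_arc_window (V : pzRingType) s : - (3 * Q%:Z) <= s -> s < 4 * Q%:Z ->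
  (in_arc s)%:R = \sum_(m < 7)
    ((0 <= s + (m%:Z - 3) * Q%:Z) && (s + (m%:Z - 3) * Q%:Z < n%:Z))%R%:R :> V.
Proof.
move=> s1 s2; have [r rQ [q sq]] := int_divQ s.
rewrite (in_arc_eq rQ); last by exists q.
rewrite {}sq in s1 s2 *.
have q1 : (-3 <= q)%R by nia.
have q2 : (q <= 3)%R by nia.
rewrite !big_ord_recr big_ord0 /= add0r.
have : (q = -3 \/ q = -2 \/ q = -1 \/ q = 0 \/ q = 1 \/ q = 2 \/ q = 3)%R by lia.
case=> [|[|[|[|[|[|]]]]]] ->;
repeat match goal with |- context [((?x <= ?y) && ?z)%R] =>
  first [have -> : ((x <= y) && z)%R = false by lia
   | have -> : ((x <= y) && z)%R = (r < n)%N by lia ] end;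
by rewrite /= ?addr0 ?add0r.
Qed.

Lemma sum_window (V : pzRingType) e :
  \sum_(r < n) ((0 <= r%:Z + e) && (r%:Z + e < n%:Z))%R%:R =
  (Num.max 0 (n%:Z - `|e|))%:~R :> V.
Proof.
have sum_ge k (p : nat) : \sum_(r < p) (k <= r)%N%:R = (p - k)%N%:R :> V.
  elim: p => [|p IH]; first by rewrite big_ord0.
  rewrite big_ord_recr /= IH -natrD; congr _%:R; lia.
have sum_lt k (p : nat) : \sum_(r < p) (r < k)%N%:R = (minn p k)%N%:R :> V.
  elim: p => [|p IH]; first by rewrite big_ord0 min0n.
  rewrite big_ord_recr /= IH -natrD; congr _%:R; lia.
case: e => e.
  transitivity (\sum_(r < n) (r < n - e)%N%:R : V).
    by apply: eq_bigr => r _; congr (nat_of_bool _)%:R; lia.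
  rewrite sum_lt.
  have -> : Num.max 0 (n%:Z - `|Posz e|)%R = (minn n (n - e))%:Z by lia.
  by [].
transitivity (\sum_(r < n) (e.+1 <= r)%N%:R : V).
  by apply: eq_bigr => r _; congr (nat_of_bool _)%:R; have := ltn_ord r; lia.
rewrite sum_ge.
have -> : Num.max 0 (n%:Z - `|Negz e|)%R = (n - e.+1)%:Z by lia.
by [].
Qed.

Lemma sum_cyclic (V : nmodType) (g : int -> V) s :
  (forall q x : int, g (q * Q%:Z + x) = g x) ->
  \sum_(l < Q) g (s - l%:Z) = \sum_(l < Q) g l%:Z.
Proof.
move=> gQ.
have h_lt (l : 'I_Q) : (`|((s - l%:Z) %% Q)%Z| < Q)%N.
  have [r rQ [q ->]] := int_divQ (s - l%:Z).
  by rewrite modzMDl modz_small // ltz_nat rQ.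
pose h (l : 'I_Q) := Ordinal (h_lt l).
have h_inj : injective h.
  move=> l l' /(congr1 val) /= eq_ll'; apply: val_inj => /=.
  move: eq_ll'.
  have [r rQ [q sq]] := int_divQ (s - l%:Z).
  have [r' rQ' [q' sq']] := int_divQ (s - l'%:Z).
  rewrite sq sq' !modzMDl !modz_small ?ltz_nat ?rQ ?rQ' //= => rr'.
  rewrite -rr' in sq'; have lQ := ltn_ord l; have lQ' := ltn_ord l'.
  have E : (q - q') * Q%:Z = l'%:Z - l%:Z by rewrite mulrBl; lia.
  have [q0|] : (q - q' = 0)%R \/ ((q - q' >= 1) || (q - q' <= -1))%R by lia.
    by move: E; rewrite q0 mul0r; lia.
  by move: (q - q')%R E => k E; case/orP => k1; nia.
rewrite [RHS](reindex_inj h_inj) /=; apply: eq_bigr => l _.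
have [r rQ [q ->]] := int_divQ (s - l%:Z).
by rewrite gQ modzMDl modz_small // ltz_nat rQ.
Qed.

Lemma in_arcDM q x : in_arc (q * Q%:Z + x) = in_arc x.
Proof. by rewrite /in_arc modzMDl. Qed.

Lemma sum_in_arc (V : pzRingType) s : \sum_(l < Q) (in_arc (s - l%:Z))%:R = n%:R :> V.
Proof.
rewrite (@sum_cyclic _ (fun x => (in_arc x)%:R)); last by move=> q x; rewrite in_arcDM.
transitivity (\sum_(l < Q | (l < n)%N) 1%R : V).
  rewrite [RHS]big_mkcond; apply: eq_bigr => l _.
  by rewrite (@in_arc_eq l l) ?ltn_ord //; [case: ifP|exists 0; ring].
transitivity (\sum_(l < n) 1%R : V); last by rewrite sumr_const card_ord.
by rewrite (big_ord_widen Q (fun=> 1%R : V)).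
Qed.

Lemma sum_in_arcM (V : pzRingType) s s' :
  - Q%:Z <= s -> s < 2 * Q%:Z -> - Q%:Z <= s' -> s' < 2 * Q%:Z ->
  \sum_(l < Q) (in_arc (s - l%:Z))%:R * (in_arc (s' - l%:Z))%:R =
  \sum_(m < 7) (Num.max 0 (n%:Z - `|s' - s + (m%:Z - 3) * Q%:Z|))%:~R :> V.
Proof.
move=> s1 s2 s1' s2'.
pose g (x : int) : V := (in_arc x)%:R * (in_arc (x + (s' - s)))%:R.
transitivity (\sum_(l < Q) g (s - l%:Z)).
  by apply: eq_bigr => l _; congr (_ * (in_arc _)%:R); ring.
rewrite sum_cyclic; last by move=> q x; rewrite /g -addrA !in_arcDM.
transitivity (\sum_(l < Q | (l < n)%N) (in_arc (l%:Z + (s' - s)))%:R : V).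
  rewrite [RHS]big_mkcond; apply: eq_bigr => l _; rewrite /g.
  rewrite (@in_arc_eq l l) ?ltn_ord //; last by exists 0; ring.
  by case: ifP; rewrite ?mul1r ?mul0r.
transitivity (\sum_(l < n) (in_arc (l%:Z + (s' - s)))%:R : V).
  by rewrite (big_ord_widen Q (fun l => (in_arc (l%:Z + (s' - s)))%:R)).
transitivity (\sum_(l < n) \sum_(m < 7) (nat_of_bool
    ((0 <= l%:Z + (s' - s) + (m%:Z - 3) * Q%:Z) &&
     (l%:Z + (s' - s) + (m%:Z - 3) * Q%:Z < n%:Z))%R)%:R : V).
  by apply: eq_bigr => l _; apply: in_arc_window; have := ltn_ord l; lia.
rewrite exchange_big; apply: eq_bigr => m _ /=; rewrite -sum_window.
by apply: eq_bigr => l _; rewrite !addrA.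
Qed.
End CyclicGrid.

Section TentEnergy.
Variables (R : realType) (I : finType) (v : I -> R) (M : nat).
Hypotheses (M0 : (0 < M)%N) (v_ge : forall i, -1 <= v i) (v_lt : forall i, v i < 2).

(* For [-1 <= s < 2] and [0 <= a < 1] this is the indicator of the 1-periodic strip
   [a <= s < a + w], written with half-lines only. *)
Definition strip_count (w a : R) (s : R) : R :=
  \sum_(m < 4) ((a + (m%:R - 2) <= s)%R%:R - (a + w + (m%:R - 2) <= s)%R%:R).

Definition tent_energy (w : R) : R :=
  \sum_i \sum_j \sum_(m < 7) tent w (v j - v i + (m%:R - 3)).

Let N : R := #|I|%:R.

Lemma tent_lipschitz w s s' : `|tent w s - tent w s'| <= `|s - s'| :> R.
Proof.
rewrite /tent.
have := ler_dist_dist s s'; set e := `|s - s'|; rewrite ler_norml => /andP[].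
move: `|s| `|s'| => a a' h1 h2.
by rewrite ler_norml; case: (leP 0 (w - a)) => ?; case: (leP 0 (w - a')) => ?;
  apply/andP; split; lra.
Qed.

(* For offsets on the grid of step 1 / (n M) the strip counts only depend on the
   integer parts of [n M v i], so the mean square over offsets is a sum over Z/(n M). *)
Lemma grid_energy (n : nat) : (0 < n)%N ->
  exists c : 'I_(n * M) -> R,
  [/\ forall l : 'I_(n * M), c l =
        \sum_i strip_count M%:R^-1 (l%:R / (n * M)%:R) (v i),
      \sum_l c l = N * n%:R &
      `|\sum_l c l ^+ 2 / (n * M)%:R - tent_energy M%:R^-1| <=
        7 * N ^+ 2 / (n * M)%:R].
Proof.
move=> n0; set Q := (n * M)%N.
have Q0 : (0 < Q)%N by rewrite muln_gt0 n0.
have nQ : (n <= Q)%N by rewrite leq_pmulr.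
have QR0 : 0 < Q%:R :> R by rewrite ltr0n.
have wQ : M%:R^-1 = n%:R / Q%:R :> R.
  by rewrite /Q natrM; field; rewrite !pnatr_eq0 -!lt0n n0 M0.
pose s i : int := Num.floor (Q%:R * v i).
have sz i (z : int) : (z <= s i) = (z%:~R <= Q%:R * v i) by exact: floor_ge_int.
have s1 i : - Q%:Z <= s i.
  rewrite sz mulrNz -mulrN1 ler_pM2l //.
have s2 i : s i < 2 * Q%:Z.
  by rewrite floor_lt_int intrM mulrC ltr_pM2r.
exists (fun l => \sum_i (in_arc Q n (s i - l%:Z))%:R); split.
- move=> l; apply: eq_bigr => i _; rewrite in_arc_threshold //.
  apply: eq_bigr => m _.
  have thr (z : int) (x : R) : z%:~R = Q%:R * x -> (z <= s i) = (x <= v i).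
    by move=> zx; rewrite sz zx ler_pM2l.
  congr ((nat_of_bool _)%:R - (nat_of_bool _)%:R); apply: thr.
    by rewrite intrD intrM intrB; field; rewrite gt_eqF.
  by rewrite wQ !intrD intrM intrB; field; rewrite gt_eqF.
- rewrite exchange_big /=; transitivity (\sum_(i : I) n%:R : R).
    by apply: eq_bigr => i _; apply: sum_in_arc.
  by rewrite sumr_const -[LHS]mulr_natl.
have -> : \sum_(l < Q) (\sum_i (in_arc Q n (s i - l%:Z))%:R) ^+ 2 / Q%:R =
    \sum_i \sum_j \sum_(m < 7)
    (Num.max 0 (n%:Z - `|s j - s i + (m%:Z - 3) * Q%:Z|))%:~R / Q%:R :> R.
  transitivity (\sum_(l < Q) \sum_i \sum_j
    (in_arc Q n (s i - l%:Z))%:R * (in_arc Q n (s j - l%:Z))%:R / Q%:R : R).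
    apply: eq_bigr => l _; rewrite expr2 !mulr_suml; apply: eq_bigr => i _.
    by rewrite mulr_sumr mulr_suml.
  rewrite exchange_big; apply: eq_bigr => i _ /=.
  rewrite exchange_big; apply: eq_bigr => j _ /=.
  by rewrite -!mulr_suml sum_in_arcM.
rewrite /tent_energy -sumrB.
have -> : 7 * N ^+ 2 / Q%:R = \sum_(i : I) \sum_(j : I) \sum_(m < 7) Q%:R^-1.
  rewrite [RHS](eq_bigr (fun=> N * (7 * Q%:R^-1))).
    by rewrite sumr_const -[RHS]mulr_natl -/N; ring.
  move=> i _; rewrite (eq_bigr (fun=> 7 * Q%:R^-1)).
    by rewrite sumr_const -[LHS]mulr_natl.
  by move=> j _; rewrite sumr_const card_ord -[LHS]mulr_natl.
apply: (le_trans (ler_norm_sum _ _ _)); apply: ler_sum => i _; rewrite -sumrB.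
apply: (le_trans (ler_norm_sum _ _ _)); apply: ler_sum => j _; rewrite -sumrB.
apply: (le_trans (ler_norm_sum _ _ _)); apply: ler_sum => m _.
set e := s j - s i + (m%:Z - 3) * Q%:Z.
have -> : (Num.max 0 (n%:Z - `|e|))%:~R / Q%:R = tent M%:R^-1 (e%:~R / Q%:R) :> R.
  rewrite /tent wQ normrM normfV (ger0_norm (ltW QR0)) -mulrBl.
  rewrite -intr_norm -[n%:R]/(n%:Z%:~R) -intrB -[0 in RHS](mul0r Q%:R^-1).
  rewrite -maxr_pMl ?invr_ge0 ?ltW // -[0 in RHS]/(0%:~R).
  congr (_ / _); case: (leP 0 (n%:Z - `|e|)) => e0.
    by rewrite max_r // ler_int.
  by rewrite max_l // ler_int ltW.
apply: (le_trans (tent_lipschitz _ _ _)).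
have -> : e%:~R / Q%:R - (v j - v i + (m%:R - 3)) =
    (((s j)%:~R - Q%:R * v j) - ((s i)%:~R - Q%:R * v i)) / Q%:R.
  by rewrite /e intrD intrM !intrB; field; rewrite gt_eqF.
rewrite normrM normfV (ger0_norm (ltW QR0)) -[leRHS]mul1r.
apply: ler_wpM2r; first by rewrite invr_ge0 ltW.
have := floor_itv (Q%:R * v j); have := floor_itv (Q%:R * v i).
rewrite -!/(s _) !intrD => /andP[h1 h2] /andP[h3 h4].
rewrite ler_norml; apply/andP; split; lra.
Qed.

Lemma grid_variance (n : nat) (c : 'I_(n * M) -> R) : (0 < n)%N ->
  \sum_l c l = N * n%:R ->
  \sum_l (c l - N * M%:R^-1) ^+ 2 / (n * M)%:R =
  \sum_l c l ^+ 2 / (n * M)%:R - N ^+ 2 * M%:R^-1 ^+ 2.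
Proof.
move=> n0 csum; rewrite -!mulr_suml.
have -> : \sum_l (c l - N * M%:R^-1) ^+ 2 = \sum_l c l ^+ 2
    - 2 * (N * M%:R^-1) * \sum_l c l + (n * M)%:R * (N * M%:R^-1) ^+ 2.
  rewrite (eq_bigr (fun l => c l ^+ 2 - 2 * (N * M%:R^-1) * c l +
    (N * M%:R^-1) ^+ 2)); last by move=> l _; ring.
  rewrite big_split sumrB -mulr_sumr /= sumr_const card_ord.
  by rewrite -[(N / M%:R) ^+ 2 *+ _]mulr_natl.
by rewrite csum natrM; field; rewrite !pnatr_eq0 -!lt0n n0 M0.
Qed.

Lemma grid_error_le (k : nat) : 7 * N ^+ 2 / (k.+1 * M)%:R <= 7 * N ^+ 2 / k.+1%:R.
Proof.
rewrite ler_wpM2l ?mulr_ge0 ?sqr_ge0 // lef_pV2 ?posrE ?ltr0n ?muln_gt0 //.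
by rewrite ler_nat leq_pmulr.
Qed.

Lemma tent_energy_ge : N ^+ 2 * M%:R^-1 ^+ 2 <= tent_energy M%:R^-1.
Proof.
apply: (@le_of_le_add_divn _ _ _ (7 * N ^+ 2)) => k.
have [c [_ csum cE]] := grid_energy (ltn0Sn k).
have kerr := grid_error_le k.
have : 0 <= \sum_l (c l - N * M%:R^-1) ^+ 2 / (k.+1 * M)%:R.
  by apply: sumr_ge0 => l _; rewrite divr_ge0 ?sqr_ge0.
rewrite (grid_variance (ltn0Sn k) csum).
move: cE kerr; rewrite ler_norml => /andP[].
set S := \sum_l _; set T := tent_energy _; set X := N ^+ 2 * _;
  set Y := 7 * N ^+ 2 / (_ * _)%:R; set Z := 7 * N ^+ 2 / _.
move=> h1 h2 h3 h4; lra.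
Qed.

Lemma tent_energy_le (E : R) :
  (forall a : R, 0 <= a < 1 -> `|\sum_i strip_count M%:R^-1 a (v i) - N * M%:R^-1| <= E) ->
  tent_energy M%:R^-1 <= N ^+ 2 * M%:R^-1 ^+ 2 + E ^+ 2.
Proof.
move=> vE; apply: (@le_of_le_add_divn _ _ _ (7 * N ^+ 2)) => k.
have [c [cv csum cE]] := grid_energy (ltn0Sn k).
have kerr := grid_error_le k.
have Q0 : 0 < (k.+1 * M)%:R :> R by rewrite ltr0n muln_gt0.
have : \sum_l (c l - N * M%:R^-1) ^+ 2 / (k.+1 * M)%:R <= E ^+ 2.
  have -> : E ^+ 2 = \sum_(l < k.+1 * M) E ^+ 2 / (k.+1 * M)%:R.
    rewrite sumr_const card_ord -[RHS]mulr_natr divfK //; exact: lt0r_neq0.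
  apply: ler_sum => l _; apply: ler_wpM2r; first by rewrite invr_ge0 ltW.
  rewrite cv -[leLHS]real_normK ?num_real //.
  have : 0 <= (l%:R : R) / (k.+1 * M)%:R < 1.
    by rewrite divr_ge0 //= ltr_pdivrMr // mul1r ltr_nat.
  move=> /vE le_E; have E0 := le_trans (normr_ge0 _) le_E.
  by apply: lerXn2r; rewrite ?nnegrE.
rewrite (grid_variance (ltn0Sn k) csum).
move: cE kerr; rewrite ler_norml => /andP[].
set S := \sum_l _; set T := tent_energy _; set X := N ^+ 2 * _;
  set Y := 7 * N ^+ 2 / (_ * _)%:R; set Z := 7 * N ^+ 2 / _.
move=> h1 h2 h3 h4; lra.
Qed.
End TentEnergy.

(** * Averaging over slopes *)

Section PairKernel.
Variables (R : realType) (w W t : R).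
Hypotheses (w0 : 0 < w) (wW : w <= W) (t0 : 0 < t).
Implicit Types (dx dy b s : R) (k : nat).

Let W0 : 0 < W. Proof. exact: lt_le_trans wW. Qed.

Definition kernel s : R := tent w s / w ^+ 2 - tent W s / W ^+ 2.

Definition kernel_primitive s : R := spline w s - spline W s.

(* A second antiderivative of [kernel (dy - b * dx)] as a function of the slope [b]. *)
Definition pair_primitive dx dy b : R :=
  if dx == 0 then kernel dy / 2 * b ^+ 2
  else (dx ^+ 2)^-1 * kernel_primitive (dy - b * dx).

Lemma has_diff2_pair dx dy :
  has_diff2 (pair_primitive dx dy) (fun b => kernel (dy - b * dx)).
Proof.
rewrite /pair_primitive; have [->|dx0] := eqVneq dx 0.
  exists 0 => s h h0; rewrite mul0r mulr0 subr0 /diff2.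
  by rewrite (_ : _ - _ = 0) ?normr0 //; field.
have [C HC] := has_diff2Z (dx ^+ 2)^-1
  (has_diff2_affine dx dy (has_diff2_spline_sub w0 wW)).
exists C => s h h0; have := HC s h h0.
rewrite /kernel_primitive /kernel.
suff -> : forall z, (dx ^+ 2)^-1 * (dx ^+ 2 * z) = z by [].
by move=> z; rewrite mulKf // expf_neq0.
Qed.

Lemma kernel_ge s : - W^-1 <= kernel s.
Proof.
rewrite /kernel -[leLHS]add0r; apply: lerD.
  by rewrite divr_ge0 ?tent_ge0 ?sqr_ge0.
rewrite lerN2 (_ : W^-1 = W / W ^+ 2); last by field; rewrite gt_eqF.
by apply: ler_wpM2r; rewrite ?invr_ge0 ?sqr_ge0 // tent_le // ltW.
Qed.

Lemma kernel_eq0 s : W <= `|s| -> kernel s = 0.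
Proof.
move=> Ws; rewrite /kernel !tent_eq0 ?mul0r ?subrr //; exact: le_trans Ws.
Qed.

Lemma kernel0 : kernel 0 = w^-1 - W^-1.
Proof. by rewrite /kernel !tent0 ?ltW //; field; rewrite !gt_eqF. Qed.

Lemma diff2_pair0 : diff2 (pair_primitive 0 0) 0 t = t ^+ 2 * (w^-1 - W^-1).
Proof. by rewrite -kernel0 /diff2 /pair_primitive eqxx; move: (kernel 0) => c; field. Qed.

Definition in_block (e : bool) k dx dy : bool :=
  (k%:R * W <= t * `|dx| < k.+1%:R * W) && (`|dy + (-1) ^+ e * t * dx| < 3 * W).

(* A telescoping substitute for 1 / k^2 that is also meaningful at k = 0. *)
Definition block_weight k : R := 2 / (k.+1%:R * k.+2%:R).

Lemma block_weight_ge0 k : 0 <= block_weight k.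
Proof. by rewrite divr_ge0 // mulr_ge0. Qed.

Lemma sum_block_weight K : \sum_(k < K) block_weight k <= 2.
Proof.
have -> : \sum_(k < K) block_weight k = 2 - 2 / K.+1%:R.
  elim: K => [|K IH]; first by rewrite big_ord0 divr1 subrr.
  rewrite big_ord_recr /= IH /block_weight -![_.+1%:R]natr1; field.
  by rewrite -?natrD !natr1 -?natrD ?natr1 ?pnatr_eq0.
by rewrite gerBl divr_ge0.
Qed.

Lemma block_weight_near k z : (0 < k)%N -> k%:R * W <= z ->
  W / 6 / z ^+ 2 <= W^-1 * block_weight k.
Proof.
move=> k0 kz; have kR : 1 <= k%:R :> R by rewrite ler1n.
have kW : 0 < k%:R * W by rewrite mulr_gt0 // (lt_le_trans ltr01).
have z0 : 0 < z := lt_le_trans kW kz.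
apply: (@le_trans _ _ (W / 6 / (k%:R * W) ^+ 2)).
  apply: ler_wpM2l; first by rewrite divr_ge0 // ltW.
  rewrite lef_pV2 ?posrE ?exprn_gt0 //; apply: lerXn2r => //; rewrite nnegrE ltW //.
have -> : W / 6 / (k%:R * W) ^+ 2 = W^-1 * (6 * k%:R ^+ 2)^-1.
  by field; rewrite !gt_eqF // (lt_le_trans ltr01).
apply: ler_wpM2l; first by rewrite invr_ge0 ltW.
rewrite /block_weight -![_.+1%:R]natr1; move: k%:R kR => c c1.
have p1 : 0 < 6 * c ^+ 2 by nra.
have p2 : 0 < (c + 1) * (c + 2) by nra.
rewrite (_ : c + 1 + 1 = c + 2); last by ring.
by rewrite ler_pdivlMr // mulrC ler_pdivrMr //; nra.
Qed.

Lemma kernel_primitive_ge s : - (W / 6) * (`|s| < W)%R%:R <= kernel_primitive s.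
Proof.
rewrite /kernel_primitive; have [_|Ws] := ltP `|s| W.
  by rewrite mulr1 spline_sub_ge.
by rewrite mulr0 spline_sub_eq0.
Qed.

Lemma diff2_pair_ge dx dy K : t * `|dx| < K%:R * W ->
  - (t ^+ 2 / W * \sum_(k < K) \sum_(e : bool) block_weight k * (in_block e k dx dy)%:R)
  <= diff2 (pair_primitive dx dy) 0 t.
Proof.
move=> dxK; set S := \sum_(k < K) _.
have th0 : 0 <= t * `|dx| by rewrite mulr_ge0 // ltW.
pose k := Num.truncn (t * `|dx| / W).
have k1 : k%:R * W <= t * `|dx|.
  by rewrite -ler_pdivlMr // truncn_le // divr_ge0 // ltW.
have k2 : t * `|dx| < k.+1%:R * W by rewrite -ltr_pdivrMr // truncnS_gt.
have kK : (k < K)%N.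
  have : k%:R * W < K%:R * W by apply: le_lt_trans dxK.
  by rewrite ltr_pM2r // ltr_nat.
have Sk : block_weight k *
    ((`|dy + t * dx| < 3 * W)%R%:R + (`|dy - t * dx| < 3 * W)%R%:R) <= S.
  rewrite /S (bigD1 (Ordinal kK)) //= big_bool /= /in_block k1 k2 /= expr0 expr1.
  rewrite mulN1r mul1r mulNr mulrDr [leLHS]addrC lerDl.
  by apply: sumr_ge0 => *; apply: sumr_ge0 => *; rewrite mulr_ge0 ?block_weight_ge0.
have tW : 0 <= t ^+ 2 / W by rewrite divr_ge0 ?sqr_ge0 // ltW.
have nt : `|t * dx| = t * `|dx| by rewrite normrM ger0_norm // ltW.
have [far|near] := leP W (t * `|dx|).
  have dx0 : dx != 0.
    by apply/eqP => dx0; move: far; rewrite dx0 normr0 mulr0 leNgt W0.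
  have k0 : (0 < k)%N.
    rewrite lt0n; apply/eqP => k0; move: k2; rewrite k0 mul1r ltNge far //.
  have bw := block_weight_near k0 k1.
  rewrite /diff2 /pair_primitive (negPf dx0) add0r sub0r !mul0r subr0 mulNr opprK.
  have G0 := spline_sub_le0 w0 wW dy; rewrite -/(kernel_primitive dy) in G0.
  have G1 := kernel_primitive_ge (dy - t * dx).
  have G2 := kernel_primitive_ge (dy + t * dx).
  have le_ind (z : R) : (`|z| < W)%R%:R <= (`|z| < 3 * W)%R%:R :> R.
    rewrite ler_nat; case: ltP => // zW; case: ltP => //; lra.
  have le1 := le_ind (dy - t * dx); have le2 := le_ind (dy + t * dx).
  have dx2 : 0 < (dx ^+ 2)^-1 by rewrite invr_gt0 exprn_even_gt0.
  apply: (@le_trans _ _ ((dx ^+ 2)^-1 * (- (W / 6) *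
     ((`|dy + t * dx| < 3 * W)%R%:R + (`|dy - t * dx| < 3 * W)%R%:R)))); last first.
    rewrite (_ : forall c A B C : R, c * A + c * B - 2 * (c * C) =
      c * (A + B - 2 * C)); last by move=> *; ring.
    apply: ler_wpM2l; first exact: ltW.
    have W6 : 0 <= W / 6 by rewrite divr_ge0 // ltW.
    move: G0 G1 G2 (ler_wpM2l W6 le1) (ler_wpM2l W6 le2).
    rewrite !mulNr mulrDr.
    move: (W / 6 * _) (W / 6 * _) (W / 6 * _) (W / 6 * _) => *; lra.
  rewrite mulrA mulrN mulNr lerN2.
  have -> : (dx ^+ 2)^-1 * (W / 6) = t ^+ 2 * (W / 6 / (t * `|dx|) ^+ 2).
    by rewrite exprMn real_normK ?num_real //; field; rewrite dx0 gt_eqF.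
  apply: le_trans (ler_wpM2l tW Sk); rewrite [leRHS]mulrA; apply: ler_wpM2r.
    exact: addr_ge0.
  by rewrite -[leRHS]mulrA; apply: ler_wpM2l => //; exact: sqr_ge0.
have [dyW|dyW] := ltP `|dy| (2 * W).
  have -> : - (t ^+ 2 / W * S) = t ^+ 2 * - (W^-1 * S) by ring.
  apply: diff2_ge (has_diff2_pair dx dy) _; first exact: ltW.
  move=> s _; apply: le_trans (kernel_ge _); rewrite lerN2 -[leLHS]mulr1.
  apply: ler_wpM2l; first by rewrite invr_ge0 ltW.
  apply: le_trans Sk.
  have k0 : k = 0%N.
    apply/eqP; rewrite -leqn0 leqNgt; apply/negP => k0.
    move: k1; rewrite leNgt => /negP; apply; apply: (lt_le_trans near).
    by rewrite ler_peMl ?ler1n // ltW.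
  have -> : (`|dy + t * dx| < 3 * W) = true.
    by apply: le_lt_trans (ler_normD _ _) _; rewrite nt; lra.
  have -> : block_weight k = 1 by rewrite k0 /block_weight; field.
  by rewrite mul1r lerDl.
apply: (@le_trans _ _ (t ^+ 2 * 0)).
  rewrite mulr0 oppr_le0 mulr_ge0 //; apply: sumr_ge0 => *; apply: sumr_ge0 => *.
  by rewrite mulr_ge0 ?block_weight_ge0.
apply: diff2_ge (has_diff2_pair dx dy) _; first exact: ltW.
move=> s st; rewrite kernel_eq0 //.
have := lerB_normD dy (- (s * dx)); rewrite normrN normrM.
have : `|s| * `|dx| <= t * `|dx| by apply: ler_wpM2r.
lra.
Qed.
End PairKernel.

Section EnergyArgument.
Variables (R : realType) (I : finType) (x y : I -> R) (t D : R).
Hypotheses (t0 : 0 < t) (t1 : t < 1).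
Hypotheses (x01 : forall i, 0 <= x i <= 1) (y01 : forall i, 0 <= y i <= 1).

Let N : R := #|I|%:R.

Definition slanted (b : R) (i : I) : R := y i - b * x i.

Hypothesis strips : forall b a w : R, `|b| <= t -> 0 <= a < 1 -> 0 < w <= 1 ->
  `|\sum_i strip_count w a (slanted b i) - N * w| <= 8 * D.

Hypothesis blocks : forall b a c u h : R, `|b| <= t -> 0 < u -> 0 < h ->
  \sum_i ((a <= x i <= a + u) && (c <= slanted b i <= c + h))%R%:R
    <= N * ((u + 4 * h) * h) + D.

Lemma kernel_energy_le (M L : nat) (b : R) : (0 < M)%N -> (0 < L)%N -> `|b| <= t ->
  \sum_i \sum_j \sum_(m < 7)
    kernel M%:R^-1 L%:R^-1 (y j - y i + (m%:R - 3) - b * (x j - x i))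
  <= 64 * D ^+ 2 * M%:R ^+ 2.
Proof.
move=> M0 L0 bt.
have bx i : - t <= b * x i <= t.
  rewrite -ler_norml normrM -[leRHS]mulr1; have /andP[x0 x1] := x01 i.
  by apply: ler_pM => //; rewrite ger0_norm.
have v1 i : -1 <= slanted b i.
  by rewrite /slanted; have := t1; have := bx i; have := y01 i => /andP[? ?] /andP[? ?] ?; lra.
have v2 i : slanted b i < 2.
  by rewrite /slanted; have := t1; have := bx i; have := y01 i => /andP[? ?] /andP[? ?] ?; lra.
have MR : 0 < M%:R :> R by rewrite ltr0n.
have LR : 0 < L%:R :> R by rewrite ltr0n.
have M1 : 0 < (M%:R^-1 : R) <= 1 by rewrite invr_gt0 MR invf_le1 // ler1n.
have eM := tent_energy_le M0 v1 v2 (fun a a01 => strips bt a01 M1).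
have eL := tent_energy_ge L0 v1 v2.
have -> : \sum_i \sum_j \sum_(m < 7)
    kernel M%:R^-1 L%:R^-1 (y j - y i + (m%:R - 3) - b * (x j - x i)) =
    tent_energy (slanted b) M%:R^-1 * M%:R ^+ 2 -
    tent_energy (slanted b) L%:R^-1 * L%:R ^+ 2.
  rewrite /tent_energy !mulr_suml -sumrB; apply: eq_bigr => i _.
  rewrite !mulr_suml -sumrB; apply: eq_bigr => j _.
  rewrite !mulr_suml -sumrB; apply: eq_bigr => m _.
  rewrite /kernel !exprVn !invrK; congr (tent _ _ * _ - tent _ _ * _);
    by rewrite /slanted; ring.
have VK (z : R) : 0 < z -> z^-1 ^+ 2 * z ^+ 2 = 1.
  by move=> z0; rewrite -exprMn mulVf ?expr1n // gt_eqF.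
have := ler_wpM2r (sqr_ge0 M%:R) eM; have := ler_wpM2r (sqr_ge0 L%:R) eL.
rewrite -/N mulrDl -!(mulrA (N ^+ 2)) !VK // mulr1 exprMn.
rewrite (_ : 8 ^+ 2 = 64 :> R); last by ring.
move: (64 * _ * _) (_ * L%:R ^+ 2) (_ * M%:R ^+ 2) (N ^+ 2) => a1 a2 a3 a4.
by move=> *; lra.
Qed.

Lemma in_block_count (W : R) (e : bool) k i m : 0 < W ->
  \sum_j (in_block W t e k (x j - x i) (y j - y i + (m%:R - 3)))%:R <=
  2 * (N * ((W / t + 24 * W) * (6 * W)) + D).
Proof.
move=> W0; set b := - ((-1) ^+ e * t).
have bt : `|b| <= t by rewrite normrN normrM normrX normrN1 expr1n mul1r ger0_norm // ltW.
have U0 : 0 < W / t by rewrite divr_gt0.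
pose c := slanted b i - (m%:R - 3) - 3 * W.
have H6 : 0 < 6 * W by rewrite mulr_gt0.
have B1 := blocks (x i + k%:R * (W / t)) c bt U0 H6.
have B2 := blocks (x i - k.+1%:R * (W / t)) c bt U0 H6.
have -> : 24 * W = 4 * (6 * W) by ring.
rewrite -[2]/(1 + 1) mulrDl mul1r.
apply: le_trans (lerD B1 B2); rewrite -big_split /=; apply: ler_sum => j _.
set P1 := (_ && _); set P2 := (_ && _); rewrite -natrD ler_nat.
have [|//] := boolP (in_block _ _ _ _ _ _); case/andP => /andP[h1 h2] h3.
suff : P1 || P2 by case: P1 P2 => [] [].
have Q : c <= slanted b j <= c + 6 * W.
  rewrite /c /slanted; move: h3; rewrite ltr_norml => /andP[].
  have -> : (-1) ^+ e * t * (x j - x i) = - b * (x j - x i) by rewrite opprK.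
  move=> h3 h4; apply/andP; split; lra.
rewrite /P1 /P2 Q !andbT.
have tU : W = t * (W / t) by field; rewrite gt_eqF.
move: (W / t) U0 tU => U U0 tU.
rewrite tU !(mulrCA _ t) ?ler_pM2l ?ltr_pM2l // in h1 h2.
have [dx|dx] := leP 0 (x j - x i).
  rewrite ger0_norm // in h1 h2; apply/orP; left.
  rewrite -natr1 mulrDl mul1r in h2; apply/andP; split; lra.
rewrite ltr0_norm // in h1 h2; apply/orP; right.
rewrite -natr1 mulrDl mul1r in h2 *; apply/andP; split; lra.
Qed.

Lemma energy_inequality (M L : nat) : (0 < L)%N -> (L <= M)%N ->
  N * (M%:R - L%:R) <= 64 * D ^+ 2 * M%:R ^+ 2 +
    56 * N * L%:R * (N * ((L%:R^-1 / t + 24 / L%:R) * (6 / L%:R)) + D).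
Proof.
move=> L0 LM; have M0 := leq_trans L0 LM.
have MR : 0 < M%:R :> R by rewrite ltr0n.
have LR : 0 < L%:R :> R by rewrite ltr0n.
set w := M%:R^-1 : R; set W := L%:R^-1 : R.
have w0 : 0 < w by rewrite invr_gt0.
have W0 : 0 < W by rewrite invr_gt0.
have wW : w <= W by rewrite lef_pV2 ?posrE // ler_nat.
pose th i j (m : 'I_7) := pair_primitive w W (x j - x i) (y j - y i + (m%:R - 3)).
pose Th b := \sum_i \sum_j \sum_(m < 7) th i j m b.
have Th2 : has_diff2 Th (fun b => \sum_i \sum_j \sum_(m < 7)
    kernel w W (y j - y i + (m%:R - 3) - b * (x j - x i))).
  apply: has_diff2_sum => i; apply: has_diff2_sum => j; apply: has_diff2_sum => m.
  exact: has_diff2_pair.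
have up : diff2 Th 0 t <= t ^+ 2 * (64 * D ^+ 2 * M%:R ^+ 2).
  apply: diff2_le Th2 _; first exact: ltW.
  by move=> b; apply: kernel_energy_le.
pose neg i j (m : 'I_7) := \sum_(k < L.+1) \sum_(e : bool) block_weight R k *
  (in_block W t e k (x j - x i) (y j - y i + (m%:R - 3)))%:R.
have neg0 i j m : 0 <= neg i j m.
  by apply: sumr_ge0 => *; apply: sumr_ge0 => *; rewrite mulr_ge0 ?block_weight_ge0.
have pair i j (m : 'I_7) :
    t ^+ 2 * ((w^-1 - W^-1) * ((i == j) && (m == 3 :> nat))%:R)
    - t ^+ 2 / W * neg i j m <= diff2 (th i j m) 0 t.
  have [/andP[/eqP <- /eqP m3]|_] := boolP ((i == j) && _).
    rewrite /th m3 !subrr addr0 diff2_pair0 // mulr1 gerBl.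
    by rewrite mulr_ge0 // divr_ge0 ?sqr_ge0 // ltW.
  rewrite !mulr0 sub0r; apply: diff2_pair_ge => //.
  have tx : t * `|x j - x i| <= t.
    rewrite ger_pMr //; move: (x01 i) (x01 j) => /andP[? ?] /andP[? ?].
    by rewrite ler_norml; apply/andP; split; lra.
  apply: (le_lt_trans tx); apply: (lt_trans t1).
  by rewrite /W ltr_pdivlMr // mul1r ltr_nat.
have negsum : \sum_i \sum_j \sum_(m < 7) neg i j m <=
    56 * N * (N * ((W / t + 24 * W) * (6 * W)) + D).
  set B := N * _ + D.
  have -> : 56 * N * B = \sum_(i : I) 56 * B.
    by rewrite sumr_const -[RHS]mulr_natl -/N; ring.
  apply: ler_sum => i _.
  have B0 : 0 <= 2 * B.
    by apply: le_trans (in_block_count false 0 i 0 W0); apply: sumr_ge0.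
  rewrite exchange_big /=.
  have -> : 56 * B = \sum_(m < 7) 8 * B.
    by rewrite sumr_const card_ord -[RHS]mulr_natl; ring.
  apply: ler_sum => m _; rewrite exchange_big /=.
  apply: (@le_trans _ _ (\sum_(k < L.+1) block_weight R k * (4 * B))).
    apply: ler_sum => k _; rewrite exchange_big big_bool /= -!mulr_sumr -mulrDr.
    apply: ler_wpM2l; first exact: block_weight_ge0.
    have := in_block_count true k i m W0; have := in_block_count false k i m W0.
    rewrite -/B; lra.
  rewrite -mulr_suml; have := sum_block_weight R L.+1.
  move: (\sum_(k < L.+1) _) => S S2; nra.
have low : t ^+ 2 * (N * (w^-1 - W^-1)) - t ^+ 2 / W * (\sum_i \sum_j \sum_(m < 7) neg i j m)
   <= diff2 Th 0 t.
  rewrite /Th diff2_sum.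
  have -> : t ^+ 2 * (N * (w^-1 - W^-1)) = \sum_(i : I) \sum_(j : I) \sum_(m < 7)
      t ^+ 2 * ((w^-1 - W^-1) * ((i == j) && (m == 3 :> nat))%:R).
    transitivity (\sum_(i : I) t ^+ 2 * (w^-1 - W^-1)).
      by rewrite sumr_const -[RHS]mulr_natl -/N; ring.
    apply: eq_bigr => i _; rewrite (bigD1 i) //= [X in _ = _ + X]big1 ?addr0; last first.
      move=> j ji; rewrite eq_sym (negPf ji) /= big1 // => m _.
      by rewrite !mulr0.
    rewrite eqxx !big_ord_recr big_ord0 /=; ring.
  rewrite mulr_sumr -sumrB; apply: ler_sum => i _.
  rewrite diff2_sum mulr_sumr -sumrB; apply: ler_sum => j _.
  rewrite diff2_sum mulr_sumr -sumrB; apply: ler_sum => m _.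
  exact: pair.
have tt : 0 < t ^+ 2 by rewrite exprn_gt0.
have := le_trans low up; rewrite /w /W !invrK -mulrA -mulrBr ler_pM2l //.
rewrite lerBlDr => fin; apply: (le_trans fin); rewrite lerD2l.
rewrite (_ : forall c : R, 56 * N * L%:R * c = L%:R * (56 * N * c)); last first.
  by move=> c; ring.
by apply: ler_wpM2l => //; exact: ltW.
Qed.

Lemma discrepancy_pow5_ge : 1 / 2 <= D ->
  N * t <= 600 * (128 * 230) ^+ 2 * D ^+ 5.
Proof.
move=> D12; have D0 : 0 < D by lra.
have [->|I0] := eqVneq N 0.
  rewrite mul0r; apply: mulr_ge0; last exact/exprn_ge0/ltW.
  by apply: mulr_ge0; [exact: ler0n | exact: sqr_ge0].
have N0 : 0 < N by rewrite lt0r I0 /N ler0n.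
have tD0 : 0 < t * D by rewrite mulr_gt0.
have exL : exists L : nat, (0 < L)%N && (150 * N <= L%:R ^+ 2 * (t * D)).
  exists (Num.truncn (150 * N / (t * D))).+1 => /=.
  rewrite -ler_pdivrMr //; set z := _ / _.
  have z1 : z < (Num.truncn z).+1%:R by rewrite truncnS_gt.
  apply: (le_trans (ltW z1)); rewrite expr2 ler_peMl // ler1n //.
(* W = 1/L and w = 1/M: the least L with 150 N / (t L^2) <= D, and M ~ 228 L D. *)
pose L := ex_minn exL.
have [L0 L1 Lmin] : [/\ (0 < L)%N, 150 * N <= L%:R ^+ 2 * (t * D) &
    forall l : nat, (0 < l)%N -> 150 * N <= l%:R ^+ 2 * (t * D) -> (L <= l)%N].
  rewrite /L; case: ex_minnP => l /andP[l0 l1] lmin; split=> // k k0 k1.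
  by apply: lmin; rewrite k0.
have LR : 1 <= L%:R :> R by rewrite ler1n.
have LD : 1 / 2 <= L%:R * D by nra.
pose M := (Num.truncn (228 * (L%:R * D))).+1.
have M1 : 228 * (L%:R * D) < M%:R by rewrite truncnS_gt.
have M2 : M%:R <= 230 * (L%:R * D).
  have : (Num.truncn (228 * (L%:R * D)))%:R <= 228 * (L%:R * D).
    by rewrite truncn_le //; lra.
  by rewrite /M -natr1; lra.
have LM : (L <= M)%N by rewrite -(ler_nat R); nra.
have En := energy_inequality L0 LM.
have B : N * ((L%:R^-1 / t + 24 / L%:R) * (6 / L%:R)) <= D.
  have LR0 : 0 < L%:R :> R by lra.
  apply: (@le_trans _ _ (150 * N / (L%:R ^+ 2 * t))); last first.
    rewrite ler_pdivrMr ?mulr_gt0 ?exprn_gt0 //.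
    by rewrite (_ : D * _ = L%:R ^+ 2 * (t * D)) //; ring.
  have -> : N * ((L%:R^-1 / t + 24 / L%:R) * (6 / L%:R)) =
    (6 + 144 * t) * N / (L%:R ^+ 2 * t) by field; rewrite !gt_eqF.
  apply: ler_wpM2r; first by rewrite invr_ge0 mulr_ge0 ?exprn_ge0 // ltW.
  by apply: ler_wpM2r; [exact: ltW | have := t1; lra].
pose K : R := 128 * 230.
have K1 : 1 <= K by rewrite /K; lra.
have N1 : N <= K * (L%:R * D ^+ 3).
  have M0 : 0 < M%:R :> R by rewrite ltr0n.
  have NL0 : 0 <= 56 * N * L%:R by rewrite !mulr_ge0 // ltW.
  have := ler_wpM2l NL0 (lerD B (lexx D)) => B'.
  have : N * (M%:R / 2) <= 64 * D ^+ 2 * M%:R ^+ 2.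
    have : M%:R / 2 <= M%:R - L%:R - 112 * (L%:R * D) by nra.
    move=> /(ler_wpM2l (ltW N0)) h; apply: (le_trans h).
    move: (le_trans En (lerD (lexx _) B')).
    rewrite -lerBlDr; apply: le_trans.
    by rewrite le_eqVlt; apply/orP; left; apply/eqP; ring.
  rewrite (_ : N * _ = (N / 2) * M%:R); last by ring.
  rewrite (_ : 64 * _ * _ = (64 * D ^+ 2 * M%:R) * M%:R); last by ring.
  rewrite ler_pM2r // => NM.
  have := ler_wpM2l (exprn_ge0 2 (ltW D0)) M2.
  rewrite (_ : D ^+ 3 = D ^+ 2 * D); last by ring.
  by rewrite /K; move: (D ^+ 2) NM => d; lra.
rewrite -/K; have D3 : 0 < D ^+ 3 by rewrite exprn_gt0.
have [L2|L2] := leqP 2 L.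
  have Lp : (L%:R - 1) ^+ 2 * (t * D) < 150 * N.
    rewrite ltNge; apply/negP => Lp; have := Lmin L.-1.
    have -> : L.-1%:R = L%:R - 1 :> R by rewrite -[in RHS](prednK L0) -natr1 addrK.
    move=> /(_ _ Lp)/wrap[|]; first by rewrite -subn1 subn_gt0.
    by rewrite -ltnS prednK // ltnn.
  have LR2 : 2 <= L%:R :> R by rewrite ler_nat.
  have L4 : L%:R ^+ 2 * (t * D) <= 600 * N.
    have : L%:R ^+ 2 <= 4 * (L%:R - 1) ^+ 2 :> R.
      rewrite -subr_ge0 (_ : _ - _ = (L%:R - 2) * (3 * L%:R - 2)); last by ring.
      by apply: mulr_ge0; lra.
    by move=> /(ler_wpM2r (ltW tD0)); lra.
  have N2 : N ^+ 2 <= (K * (L%:R * D ^+ 3)) ^+ 2.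
    by apply: lerXn2r; rewrite // nnegrE ?(le_trans _ N1) // ltW.
  have KD : 0 <= K ^+ 2 * D ^+ 5 by rewrite mulr_ge0 ?exprn_ge0 // ltW // (lt_le_trans _ K1).
  have := ler_wpM2r (ltW t0) N2; have := ler_wpM2l KD L4.
  rewrite (_ : _ * D ^+ 5 * _ = (K * (L%:R * D ^+ 3)) ^+ 2 * t); last by ring.
  move=> h1 h2; have := le_trans h2 h1.
  rewrite (_ : N ^+ 2 * t = N * t * N); last by ring.
  rewrite (_ : K ^+ 2 * _ * _ = 600 * K ^+ 2 * D ^+ 5 * N); last by ring.
  by rewrite ler_pM2r.
have L1' : L%:R = 1 :> R by apply/eqP; rewrite pnatr_eq1 eqn_leq -ltnS L2.
rewrite L1' mul1r in N1.
apply: (@le_trans _ _ (K * D ^+ 3)).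
  by apply: le_trans N1; rewrite ger_pMr // ltW.
have -> : 600 * K ^+ 2 * D ^+ 5 = (600 * K * D ^+ 2) * (K * D ^+ 3) by ring.
apply: ler_peMl; first by apply: mulr_ge0; [lra | exact: ltW].
have D2 : 1 / 4 <= D ^+ 2 by nra.
have := ler_pM _ _ K1 D2; rewrite ?mul1r => /(_ _ _)/wrap[||]; lra.
Qed.
End EnergyArgument.

Local Open Scope classical_set_scope.
Local Open Scope ring_scope.

(** * Areas of half-planes and rectangles *)

Section Geometry.
Variable R : realType.
Implicit Types (a b c h u w x y l : R) (p : R * R).

Let mu := @lebesgue_measure R.

Definition upper_region b c : set (R * R) :=
  [set p | unit_square p /\ c <= p.2 - b * p.1].

Definition section_length b c x : R := Num.max 0 (1 - Num.max 0 (c + b * x)).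

Lemma measure_itvcc x y : mu `[x, y] = (Num.max 0 (y - x))%:E.
Proof.
rewrite /mu lebesgue_measure_itv /= lte_fin; have [xy|yx] := ltP x y.
  by rewrite max_r // subr_ge0 ltW.
by rewrite max_l // subr_le0.
Qed.

Lemma measurable_section_length b c (D : set R) :
  measurable_fun D (section_length b c).
Proof.
apply: measurable_maxr; first exact: measurable_cst.
apply: measurable_funB; first exact: measurable_cst.
apply: measurable_maxr; first exact: measurable_cst.
apply: measurable_funD; first exact: measurable_cst.
by apply: measurable_funM; [exact: measurable_cst | exact: measurable_id].
Qed.

Lemma integrable_section_length b c :
  mu.-integrable `[0, 1] (EFin \o section_length b c).
Proof.
apply: measurable_bounded_integrable => //.
- by rewrite /= -/mu measure_itvcc ltry.
- exact: measurable_section_length.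
exists 1; split; first exact: num_real.
move=> M M1 x _ /=; rewrite ger0_norm ?le_max ?lexx //.
apply: le_trans (ltW M1); rewrite ge_max ler01 lerBlDr lerDl le_max lexx //.
Qed.

Lemma area_upper_region b c :
  area (upper_region b c) = (\int[mu]_(x in `[0, 1]) section_length b c x)%:E.
Proof.
rewrite /Rintegral fineK; last first.
  by apply: integrable_fin_num => //; exact: integrable_section_length.
rewrite [RHS]integral_mkcond /area; apply: eq_integral => x _ /=.
rewrite patchE; case: ifPn => [|]; rewrite ?inE ?notin_setE /= in_itv /= => x01.
  rewrite -[RHS]/((Num.max 0 (1 - Num.max 0 (c + b * x)))%:E) -measure_itvcc.
  congr (mu _); apply/seteqP; split=> y.
    move=> /xsectionP [[_ /=]]; rewrite !in_itv /= => /andP[y0 y1] cy.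
    by rewrite ge_max y0 y1 -lerBrDr andbT.
  rewrite /= in_itv /= ge_max => /andP[/andP[y0 cy] y1]; apply/xsectionP.
  split; last by rewrite /= lerBrDr.
  by split; rewrite /= in_itv /= ?y0.
rewrite (_ : xsection _ _ = set0) ?measure0 //.
apply/seteqP; split=> y // /xsectionP [[/=]].
by rewrite in_itv /= => /x01.
Qed.

Lemma Rintegral_sum_ord n (f : nat -> R -> R) :
  (forall m, mu.-integrable `[0, 1] (EFin \o f m)) ->
  mu.-integrable `[0, 1] (EFin \o (fun x => \sum_(m < n) f m x)) /\
  \sum_(m < n) \int[mu]_(x in `[0, 1]) f m x =
    \int[mu]_(x in `[0, 1]) (\sum_(m < n) f m x).
Proof.
move=> intf; elim: n => [|n [IH1 IH2]].
  have -> : (fun x => \sum_(m < 0) f m x) = cst 0.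
    by apply/funext => x; rewrite big_ord0.
  split; first exact: integrable0.
  by rewrite big_ord0 Rintegral_cst // mul0r.
have -> : (fun x => \sum_(m < n.+1) f m x) =
    (fun x => (\sum_(m < n) f m x) + f n x).
  by apply/funext => x; rewrite big_ord_recr.
split; last by rewrite big_ord_recr /= IH2 -RintegralD.
have H := integrableD (mu := mu) (measurable_itv _) IH1 (intf n).
exact: H.
Qed.

Lemma sum_section_length b c x : -1 <= c + b * x <= 3 ->
  \sum_(m < 4) section_length b (c + (m%:R - 2)) x = 3 - (c + b * x).
Proof.
have low u : u <= 0 -> Num.max 0 (1 - Num.max 0 u) = 1.
  by move=> u0; rewrite (max_l u0) subr0 max_r.
have mid u : 0 <= u <= 1 -> Num.max 0 (1 - Num.max 0 u) = 1 - u.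
  by case/andP => u0 u1; rewrite (max_r u0) max_r // subr_ge0.
have high u : 1 <= u -> Num.max 0 (1 - Num.max 0 u) = 0.
  by move=> u1; rewrite [Num.max 0 u]max_r ?max_l ?subr_le0 // (le_trans _ u1).
rewrite !big_ord_recr big_ord0 /section_length /= add0r.
have E k : c + k + b * x = (c + b * x) + k by ring.
rewrite !E; move: (c + b * x) => u /andP[u0 u3].
have [h0|h0] := leP u 0.
  rewrite (low (u + (0 - 2))) ?(low (u + (1 - 2))) ?(low (u + (2 - 2))) ?(mid (u + (3 - 2)));
    try (apply/andP; split); lra.
have [h1|h1] := leP u 1.
  rewrite (low (u + (0 - 2))) ?(low (u + (1 - 2))) ?(mid (u + (2 - 2))) ?(high (u + (3 - 2)));
    try (apply/andP; split); lra.
have [h2|h2] := leP u 2.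
  rewrite (low (u + (0 - 2))) ?(mid (u + (1 - 2))) ?(high (u + (2 - 2))) ?(high (u + (3 - 2)));
    try (apply/andP; split); lra.
rewrite (mid (u + (0 - 2))) ?(high (u + (1 - 2))) ?(high (u + (2 - 2))) ?(high (u + (3 - 2)));
  try (apply/andP; split); lra.
Qed.

Lemma sum_area_strips b a w : `|b| < 1 -> 0 <= a < 1 -> 0 < w <= 1 ->
  \sum_(m < 4) (fine (area (upper_region b (a + (m%:R - 2)))) -
     fine (area (upper_region b (a + w + (m%:R - 2))))) = w.
Proof.
move=> b1 /andP[a0 a1] /andP[w0 w1].
pose F c (m : nat) x := section_length b (c + (m%:R - 2)) x.
have intF c m : mu.-integrable `[0, 1] (EFin \o F c m).
  exact: integrable_section_length.
have sumF c : \sum_(m < 4) fine (area (upper_region b (c + (m%:R - 2)))) =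
    \int[mu]_(x in `[0, 1]) (\sum_(m < 4) F c m x).
  rewrite -(Rintegral_sum_ord 4 (intF c)).2.
  by apply: eq_bigr => m _; rewrite area_upper_region.
rewrite sumrB !sumF -RintegralB //; try exact: (Rintegral_sum_ord 4 (intF _)).1.
rewrite (@eq_Rintegral _ _ _ _ _ (cst w)).
  by rewrite Rintegral_cst //= -/mu measure_itvcc /= subr0 max_r // mulr1.
move=> x; rewrite inE /= in_itv /= => /andP[x0 x1].
have : `|b * x| < 1.
  by rewrite normrM (ger0_norm x0); apply: le_lt_trans b1; rewrite ler_piMr.
rewrite ltr_norml => /andP[bx1 bx2].
by rewrite !sum_section_length; [ring | lra..].
Qed.

Lemma mem_rectangle w (o : R * R) l1 l2 p :
  rectangle w o l1 l2 p <->
  0 <= (p.1 - o.1) * cos w + (p.2 - o.2) * sin w <= l1 /\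
  0 <= (p.2 - o.2) * cos w - (p.1 - o.1) * sin w <= l2.
Proof.
have cs : cos w ^+ 2 + sin w ^+ 2 = 1 by exact: cos2Dsin2.
split.
  case=> -[s1 s2] [/=]; rewrite !in_itv /= => s1l s2l <- /=.
  rewrite (_ : _ + _ = s1 * (cos w ^+ 2 + sin w ^+ 2)); last by ring.
  rewrite (_ : _ - _ = s2 * (cos w ^+ 2 + sin w ^+ 2)); last by ring.
  by rewrite cs !mulr1.
case=> h1 h2; exists ((p.1 - o.1) * cos w + (p.2 - o.2) * sin w,
   (p.2 - o.2) * cos w - (p.1 - o.1) * sin w).
  by split; rewrite /= in_itv.
rewrite [RHS]surjective_pairing /=; congr (_, _).
  rewrite -[RHS](subrK o.1) -[p.1 - o.1 in RHS]mulr1 -cs; ring.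
rewrite -[RHS](subrK o.2) -[p.2 - o.2 in RHS]mulr1 -cs; ring.
Qed.

Section Slope.
Variable b : R.
Hypothesis b1 : `|b| <= 1.

Let C := cos (atan b).

Lemma cos_atan_gt0 : 0 < C.
Proof. by rewrite /C cos_atan invr_gt0 sqrtr_gt0 ltr_pwDl // sqr_ge0. Qed.

Lemma sin_atan : sin (atan b) = b * C.
Proof.
by rewrite -{2}[b]atanK /tan -/C divfK // gt_eqF // cos_atan_gt0.
Qed.

Lemma mem_rectangle_atan (o : R * R) l1 l2 p :
  rectangle (atan b) o (C * l1) (C * l2) p <->
  0 <= (p.1 - o.1) + b * (p.2 - o.2) <= l1 /\
  0 <= (p.2 - b * p.1) - (o.2 - b * o.1) <= l2.
Proof.
have C0 := cos_atan_gt0; rewrite mem_rectangle sin_atan -/C.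
rewrite (_ : _ + _ = C * ((p.1 - o.1) + b * (p.2 - o.2))); last by ring.
rewrite (_ : _ * C - _ = C * ((p.2 - b * p.1) - (o.2 - b * o.1))); last by ring.
by rewrite !pmulr_rge0 // !ler_pM2l.
Qed.

Lemma upper_region_rectangle c : exists (o : R * R) (l1 l2 : R),
  [/\ 0 < l1, 0 < l2 &
    rectangle (atan b) o l1 l2 `&` unit_square = upper_region b c].
Proof.
have C0 := cos_atan_gt0.
pose X : R := 2 + `|c|.
have X2 : 2 <= X by rewrite lerDl.
exists (- X, c - b * X), (C * (5 * X)), (C * (3 * X)).
split; [by rewrite mulr_gt0 //; lra | by rewrite mulr_gt0 //; lra |].
have cX : - X <= c + 2 /\ c - 2 <= X.
  by rewrite /X; have := ler_norm c; have := ler_norm (- c); rewrite normrN; split; lra.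
have bl : - 1 <= b <= 1 by rewrite -ler_norml.
apply/seteqP; split=> -[x y] /=.
  by case=> /mem_rectangle_atan /= [_ /andP[h _]] sq; split => //=; lra.
case=> -[/=]; rewrite !in_itv /= => /andP[x0 x1] /andP[y0 y1] cy.
split; last by split; rewrite /= in_itv /= ?x0 ?y0.
apply/mem_rectangle_atan => /=.
have : `|b * (y - c)| <= 1 + `|c|.
  rewrite normrM -[leRHS]mul1r; apply: ler_pM => //.
  by apply: le_trans (ler_normB _ _) _; rewrite lerD2r ger0_norm.
rewrite ler_norml => /andP[h1 h2].
have X0 : 0 <= X by lra.
have bb : 0 <= b * (b * X) <= X.
  rewrite mulrA -expr2 mulr_ge0 ?sqr_ge0 //= ler_piMl //.
  by rewrite -[b ^+ 2]real_normK ?num_real // exprn_ile1.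
have bx : - 1 <= b * x <= 1.
  by rewrite -ler_norml normrM (ger0_norm x0) mulr_ile1.
rewrite (_ : y - (c - b * X) = y - c + b * X); last by ring.
have cE : `|c| = X - 2 by rewrite /X addrAC subrr add0r.
rewrite mulrDr; move: cy h1 h2 bb bx; rewrite /= cE mulrN.
move: (b * (y - c)) (b * (b * X)) (b * X) (b * x) => z1 z2 z3 z4 cy h1 h2.
by move=> /andP[? ?] /andP[? ?]; split; apply/andP; split; lra.
Qed.

Lemma measurable_rectangle_atan (o : R * R) l1 l2 :
  measurable (rectangle (atan b) o (C * l1) (C * l2) `&` unit_square).
Proof.
apply: measurableI; last by apply: measurableX.
have m1 : measurable_fun [set: R * R] (fst : R * R -> R) := measurable_fst.
have m2 : measurable_fun [set: R * R] (snd : R * R -> R) := measurable_snd.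
pose f p := (p.1 - o.1) + b * (p.2 - o.2).
pose g p := (p.2 - b * p.1) - (o.2 - b * o.1).
have mc (r : R) : measurable_fun [set: R * R] (cst r : R * R -> R) := measurable_cst r.
have mf : measurable_fun setT f.
  apply: measurable_funD; first exact: measurable_funB.
  by apply: measurable_funM => //; exact: measurable_funB.
have mg : measurable_fun setT g.
  by apply: measurable_funB => //; apply: measurable_funB => //; exact: measurable_funM.
rewrite (_ : rectangle _ _ _ _ = (setT `&` f @^-1` `[0, l1]) `&` (setT `&` g @^-1` `[0, l2])).
  by apply: measurableI; [exact: mf | exact: mg].
apply/seteqP; split => p.
  by move=> /mem_rectangle_atan [h1 h2]; split; split => //=; rewrite in_itv.
case=> -[_ /=]; rewrite in_itv /= => h1 [_ /=]; rewrite in_itv /= => h2.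
exact/mem_rectangle_atan.
Qed.

Lemma block_rectangle a c u h : 0 < u -> 0 < h -> exists (o : R * R) (l1 l2 : R),
  [/\ 0 < l1, 0 < l2,
    forall p, a <= p.1 <= a + u -> c <= p.2 - b * p.1 <= c + h ->
      rectangle (atan b) o l1 l2 p &
    (area (rectangle (atan b) o l1 l2 `&` unit_square) <=
      ((u + 4 * h) * h)%:E)%E].
Proof.
move=> u0 h0; have C0 := cos_atan_gt0.
pose q : R := 1 + b ^+ 2.
have q1 : 1 <= q by rewrite lerDl sqr_ge0.
pose l1 := q * (u + h) + h.
have l10 : 0 < l1 by rewrite /l1; nra.
pose o : R * R := (a - h, c + b * (a - h)).
have bv v : 0 <= v <= h -> - h <= b * v <= h.
  case/andP => v0 vh; rewrite -ler_norml normrM (ger0_norm v0).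
  by rewrite -[leRHS]mul1r; apply: ler_pM.
have fE p : (p.1 - o.1) + b * (p.2 - o.2) =
    q * (p.1 - a + h) + b * (p.2 - b * p.1 - c) by rewrite /q /=; ring.
have gE p : (p.2 - b * p.1) - (o.2 - b * o.1) = p.2 - b * p.1 - c.
  by rewrite /=; ring.
exists o, (C * l1), (C * h); split; [exact: mulr_gt0 | exact: mulr_gt0 | |].
  move=> p /andP[p1 p2] /andP[v1 v2]; apply/mem_rectangle_atan.
  rewrite fE gE; have : 0 <= p.2 - b * p.1 - c <= h by apply/andP; split; lra.
  move=> vh; split => //; have /andP[w1 w2] := bv _ vh.
  by rewrite /l1; apply/andP; split; nra.
set M := _ `&` _.
have mM : measurable M by exact: measurable_rectangle_atan.
have Mx p : M p -> a - 2 * h <= p.1 <= a + u + 2 * h /\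
    c + b * p.1 <= p.2 <= c + b * p.1 + h.
  case=> /mem_rectangle_atan; rewrite fE gE => -[/andP[f1 f2] g] _.
  have /andP[w1 w2] := bv _ g; case/andP: g => g1 g2.
  rewrite /l1 in f2; split; apply/andP; split; try lra; nra.
pose J := `[a - 2 * h, a + u + 2 * h]%classic.
have -> : area M = (\int[mu]_(x in J) mu (xsection M x))%E.
  rewrite integral_mkcond; apply: eq_integral => x _ /=.
  rewrite patchE; case: ifPn => //; rewrite notin_setE /J /= in_itv /= => xJ.
  rewrite (_ : xsection _ _ = set0) ?measure0 //.
  by apply/seteqP; split=> y // /xsectionP /Mx [].
apply: (@le_trans _ _ (\int[mu]_(x in J) h%:E)%E).
  apply: ge0_le_integral => //.
  - exact: measurable_itv.
  - by have mf := measurable_fun_xsection mu mM; exact: measurable_funTS mf.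
  - move=> x _; apply: (@le_trans _ _ (mu `[c + b * x, c + b * x + h])).
      apply: le_measure; rewrite ?inE //; first exact: measurable_xsection.
      by move=> y /xsectionP /Mx [_ /=]; rewrite in_itv.
    by rewrite measure_itvcc lee_fin addrAC subrr add0r max_r // ltW.
rewrite integral_cst; last exact: measurable_itv.
rewrite /= -/mu /J measure_itvcc -EFinM lee_fin max_r; last by lra.
by rewrite (_ : a + u + 2 * h - (a - 2 * h) = u + 4 * h) ?[h * _]mulrC //; ring.
Qed.

End Slope.
End Geometry.

Lemma atan_le_id (R : realType) (x : R) : 0 < x -> atan x <= x.
Proof.
move=> x0.
have datan z : z \in `]0, x[ -> is_derive z 1 atan (1 + z ^+ 2)^-1.
  by move=> _; exact: is_derive1_atan.
have catan : {within `[0, x], continuous (@atan R)}.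
  by apply: derivable_within_continuous => z _; exact: ex_derive.
have [z _] := MVT x0 datan catan; rewrite atan0 !subr0 => ->.
rewrite ler_piMl //; first exact: ltW.
by rewrite invf_le1 ?lerDl ?sqr_ge0 // ltr_pwDl // sqr_ge0.
Qed.

Lemma atan_itv (R : realType) (theta b : R) : 0 < theta -> `|b| <= theta ->
  `[- theta, theta]%classic (atan b).
Proof.
move=> t0; rewrite ler_norml /= in_itv /= => /andP[b1 b2].
have tt := atan_le_id t0; apply/andP; split.
  by apply: le_trans (le_atan b1); rewrite atanN lerN2.
exact: le_trans (le_atan b2) tt.
Qed.

Lemma card_fset_sum (R : realType) (P : {fset R * R}) (A : set (R * R)) :
  (#|` [fset p in P | p \in A]%fset|)%:R = \sum_(i : P) (val i \in A)%:R :> R.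
Proof.
rewrite card_fset_sum1 big_fset /= big_seq_fsetE /= big_mkcond /= natr_sum.
by apply: eq_bigr => i _; case: (_ \in A).
Qed.

Section Discrepancy.
Variables (R : realType) (P : {fset R * R}) (theta D : R).
Hypotheses (theta0 : 0 < theta) (theta1 : theta < 1).
Hypothesis P_square : [set` P] `<=` unit_square.
Hypothesis P_card : (0 < #|` P|)%N.
Hypothesis P_disc : forall A : set (R * R), rectangles `[- theta, theta]%classic A ->
  (local_discrepancy P A <= D%:E)%E.

Let x (i : P) : R := (val i).1.
Let y (i : P) : R := (val i).2.
Let N : R := #|{: P}|%:R.

Lemma point_square (i : P) : unit_square (val i).
Proof. by apply: P_square; exact: (valP i). Qed.

Lemma x_itv i : 0 <= x i <= 1.
Proof. by have [] := point_square i; rewrite /= in_itv. Qed.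

Lemma y_itv i : 0 <= y i <= 1.
Proof. by have [_] := point_square i; rewrite /= in_itv. Qed.

Lemma count_discrepancy (A : set (R * R)) : rectangles `[- theta, theta]%classic A ->
  area (A `&` unit_square) \is a fin_num ->
  `|\sum_(i : P) (val i \in A)%:R - N * fine (area (A `&` unit_square))| <= D.
Proof.
move=> /P_disc + fin; rewrite /local_discrepancy -{1}(fineK fin).
rewrite -EFinM -EFinB abse_EFin lee_fin card_fset_sum cardfE.
by [].
Qed.

Lemma upper_count b c : `|b| <= theta ->
  `|\sum_(i : P) (c <= slanted x y b i)%R%:R - N * fine (area (upper_region b c))| <= D.
Proof.
move=> bt; have b1 : `|b| <= 1 by apply: le_trans bt (ltW theta1).
have [p0 [l1 [l2 [l10 l20 AE]]]] := upper_region_rectangle b1 c.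
have Arect : rectangles `[- theta, theta]%classic (rectangle (atan b) p0 l1 l2).
  by exists (atan b), p0, l1, l2; split=> //; exact: atan_itv.
have := count_discrepancy Arect; rewrite AE area_upper_region => /(_ isT).
congr (`|_ - _| <= _); apply: eq_bigr => i _; congr (nat_of_bool _)%:R.
have := point_square i; set A := rectangle _ _ _ _ => sq.
have E : A (val i) <-> c <= slanted x y b i.
  have : (A `&` unit_square) (val i) <-> upper_region b c (val i) by rewrite AE.
  by rewrite /upper_region /= => -[h1 h2]; split=> [Ai|ci]; [have [] := h1 (conj Ai sq) | have [] := h2 (conj sq ci)].
by apply/idP/idP => [/set_mem /E|/E Ai]; last exact: mem_set.
Qed.

Lemma strips_discrepancy b a w : `|b| <= theta -> 0 <= a < 1 -> 0 < w <= 1 ->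
  `|\sum_(i : P) strip_count w a (slanted x y b i) - N * w| <= 8 * D.
Proof.
move=> bt a01 w01; have b1 : `|b| < 1 by apply: le_lt_trans theta1.
rewrite -{2}(sum_area_strips b1 a01 w01) /strip_count exchange_big /= mulr_sumr -sumrB.
have -> : 8 * D = \sum_(m < 4) 2 * D.
  by rewrite sumr_const card_ord -[RHS]mulr_natl; ring.
apply: (le_trans (ler_norm_sum _ _ _)); apply: ler_sum => m _.
have h1 := upper_count (a + (m%:R - 2)) bt.
have h2 := upper_count (a + w + (m%:R - 2)) bt.
rewrite (_ : 2 * D = D + D); last by ring.
have regroup (r1 r2 r3 r4 r5 : R) :
    r1 - r2 - r3 * (r4 - r5) = (r1 - r3 * r4) - (r2 - r3 * r5) by ring.
rewrite sumrB regroup; apply: le_trans (lerD h1 h2); exact: ler_normB.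
Qed.

Lemma blocks_discrepancy b a c u h : `|b| <= theta -> 0 < u -> 0 < h ->
  \sum_(i : P) ((a <= x i <= a + u) && (c <= slanted x y b i <= c + h))%R%:R
    <= N * ((u + 4 * h) * h) + D.
Proof.
move=> bt u0 h0; have b1 : `|b| <= 1 by apply: le_trans bt (ltW theta1).
have [p0 [l1 [l2 [l10 l20 cover area_le]]]] := block_rectangle b1 a c u0 h0.
set A := rectangle _ _ _ _ in cover area_le.
have Arect : rectangles `[- theta, theta]%classic A.
  by exists (atan b), p0, l1, l2; split=> //; exact: atan_itv.
have area0 : (0 <= area (A `&` unit_square))%E by apply: integral_ge0.
have fin : area (A `&` unit_square) \is a fin_num.
  by rewrite ge0_fin_numE // (le_lt_trans area_le) // ltry.
have := count_discrepancy Arect fin; rewrite ler_norml => /andP[_].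
rewrite lerBlDl => h1; apply: (@le_trans _ _ (\sum_(i : P) (val i \in A)%:R)).
  apply: ler_sum => i _; rewrite ler_nat; case: andP => // -[xi si].
  by rewrite mem_set //; apply: cover.
apply: (le_trans h1); rewrite lerD2r; apply: ler_wpM2l; first exact: ler0n.
by rewrite -lee_fin fineK.
Qed.

Lemma half_le_discrepancy : 1 / 2 <= D.
Proof.
have N1 : 1 <= N by rewrite /N ler1n -cardfE.
have [i] : exists i : P, true.
  by move: P_card; rewrite cardfE => /card_gt0P [i _]; exists i.
pose e := (10 * N)^-1.
have e0 : 0 < e by rewrite invr_gt0; lra.
have t00 : `|0 : R| <= theta by rewrite normr0 ltW.
have := blocks_discrepancy (x i) (slanted x y 0 i) t00 e0 e0.
rewrite (bigD1 i) //= !lexx !lerDl (ltW e0) /= => h1.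
have : 1 <= N * ((e + 4 * e) * e) + D.
  apply: le_trans h1; rewrite lerDl; exact: sumr_ge0.
have -> : N * ((e + 4 * e) * e) = 1 / (20 * N).
  by rewrite /e; field; rewrite gt_eqF // (lt_le_trans ltr01).
have : 1 / (20 * N) <= 1 / 20 by rewrite ler_pM2l // lef_pV2 ?posrE; lra.
lra.
Qed.

Lemma card_le_discrepancy_pow5 :
  N * theta <= 600 * (128 * 230) ^+ 2 * D ^+ 5.
Proof.
exact: (discrepancy_pow5_ge theta0 theta1 x_itv y_itv strips_discrepancy
  blocks_discrepancy half_le_discrepancy).
Qed.

End Discrepancy.

Theorem corollary1p2 (R : realType) :
  exists c' : R, 0 < c' /\
    forall (theta : R) (N : nat), 0 < theta < pi / 4 -> (0 < N)%N ->
      ((c' * theta * N%:R `^ (1 / 5))%R%:E <=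
        optimal_discrepancy N (rectangles `[(- theta)%R, theta]))%E.
Proof.
pose C : R := 600 * (128 * 230) ^+ 2.
have C1 : 1 <= C by rewrite /C; nra.
exists C^-1; split; first by rewrite invr_gt0; lra.
move=> theta N /andP[theta0 theta_pi] N0.
have theta1 : theta < 1 by have := @pihalf_lt2 R; lra.
apply: le_ereal_inf_tmp => _ [P [P_square P_card] <-].
rewrite leNgt; apply/negP => disc_lt; set D := C^-1 * theta * _ in disc_lt.
have P_disc A : rectangles `[- theta, theta]%classic A ->
    (local_discrepancy P A <= D%:E)%E.
  by move=> FA; apply: le_trans (ltW disc_lt); apply: ereal_sup_ubound; exists A.
rewrite -P_card in N0.
have := card_le_discrepancy_pow5 theta0 theta1 P_square N0 P_disc.
rewrite -cardfE P_card -/C leNgt => /negP; apply.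
have NR : 0 < N%:R :> R by rewrite ltr0n -P_card.
have -> : D ^+ 5 = C^-1 ^+ 5 * theta ^+ 5 * N%:R.
  rewrite /D !exprMn; congr (_ * _).
  rewrite -powR_mulrn ?powR_ge0 // -powRrM (_ : 1 / 5 * 5%:R = 1); last by field.
  by rewrite powRr1 // ltW.
have C0 : 0 < C by lra.
have -> : C * (C^-1 ^+ 5 * theta ^+ 5 * N%:R) = N%:R * (C^-1 ^+ 4 * theta ^+ 5).
  by field; rewrite gt_eqF.
rewrite ltr_pM2l //; apply: (@le_lt_trans _ _ (theta ^+ 5)).
  apply: ler_piMl; first exact/exprn_ge0/ltW.
  by apply: exprn_ile1; rewrite ?invf_le1 // invr_ge0 ltW.
by rewrite exprS gtr_pMr // exprn_ilt1 // ltW.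
Qed.
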